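(* Let $(G,\Omega)$ be a finite primitive permutation group with $G$ solvable. Let $p$ be a prime such that $p^2$ divides $|G|$. Then $(G,\Omega)$ is $p$-moderate, i.e. there exists a subset $\Delta\subseteq\Omega$ whose setwise stabilizer satisfies $$1<|\mathrm{Stab}_G(\Delta)|_p<|G|_p.$$
   Context: A permutation group $(G,\Omega)$ is a finite group $G$ acting faithfully on a finite set $\Omega$; it is primitive if it is transitive and preserves no nontrivial partition of $\Omega$. For a finite group $X$ and a prime $p$, $|X|_p$ denotes the largest power of $p$ dividing $|X|$. For $\Delta\subseteq\Omega$, $\mathrm{Stab}_G(\Delta)$ is the setwise stabilizer of $\Delta$ in $G$. The permutation group $(G,\Omega)$ is called $p$-moderate if there is a subset $\Delta\subseteq\Omega$ with $1<|\mathrm{Stab}_G(\Delta)|_p<|G|_p$. *)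

(* Defs.v *)
From mathcomp Require Import all_boot all_fingroup all_solvable.

Set Implicit Arguments.
Unset Strict Implicit.
Unset Printing Implicit Defensive.

Local Open Scope group_scope.

(* The permuted set is the whole finite type T; faithfulness of the action of G
   is not part of this definition. For X : {set gT}, #|X|`_p is the p-part of
   #|X|, and 'N_G(Delta | to) is the setwise stabiliser of Delta in G. *)
Definition p_moderate (gT : finGroupType) (T : finType)
    (G : {group gT}) (to : {action gT &-> T}) (p : nat) : Prop :=
  exists Delta : {set T}, (1 < #|'N_G(Delta | to)|`_p < #|G|`_p)%N.

(* Main.v *)
(* A minimal normal subgroup V of G is abelian and regular. If V is a p-group it
   lies in every Sylow p-subgroup, so no proper nonempty set has a stabiliser of
   full p-part, and it suffices to find one whose stabiliser has order divisible
   by p. Otherwise let x of order p fix as many points as possible and write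
   V = W U with W = [V, x] and U = C_V(x). Identifying the permuted set with V, take
   Delta to be a union of x-invariant subsets of the cosets W a, a in U, whose
   sizes colour U so rigidly that a p-element commuting with x and stabilising
   Delta must fix 1 and centralise U. If the stabiliser of Delta had full p-part,
   it would contain such an element outside <x>; multiplied by a power of x it
   also fixes a point outside U, contradicting the choice of x. *)
Require Import Defs.
From mathcomp Require Import all_boot all_fingroup all_solvable.

Set Implicit Arguments.
Unset Strict Implicit.
Unset Printing Implicit Defensive.

Local Open Scope group_scope.

(** * Rigid pairs of subsets of a group *)

Lemma rigid_pair (gT : finGroupType) (U : {group gT}) :
  exists A B : {set gT},
    [/\ <<A>> = U, A \subset U^#, B \subset U^#, [disjoint A & B]
      & forall y, coprime #|U| #[y] -> y \in 'N(A) -> y \in 'N(B) ->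
        y \in 'C(U)].
Proof.
(* Take M maximal in U and e outside M; from a pair (A, B) for M pass to
   (B :|: e *: M, A). Then M = <<A>> is recovered, and so are B and e *: M. *)
have [n] := ubnP #|U|; elim: n U => // n IHn U /ltnSE-leUn.
have [U1 | ntU] := eqsVneq U 1.
  exists set0, set0; split; rewrite ?sub0set ?gen0 ?U1 -?setI_eq0 ?set0I //.
  by move=> y _ _ _; rewrite cent1T inE.
have [M maxM _]: {M : {group gT} | maxgroup M (fun M => M \proper U)
    & 1%G \subset M}.
  by apply: maxgroup_exists; rewrite proper1G.
have [prMU maxMU] := maxgroupP maxM; have sMU := proper_sub prMU.
have [_ [e Ue notMe]] := properP prMU.
have genU : <<e |: M>> = U.
  apply/eqP; rewrite eqEsubset gen_subG subUset sub1set Ue sMU /=.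
  apply: contraR notMe => nsU; rewrite -(maxMU <<e |: M>>%G) //=.
  - by rewrite mem_gen // setU11.
  - by rewrite properE gen_subG subUset sub1set Ue sMU.
  - exact: subset_trans (subsetUr _ _) (subset_gen _).
have [A [B [genA sAM sBM dAB rigid]]] := IHn M (leq_trans (proper_card prMU) leUn).
have eM1 w : w \in e *: M -> w \notin M.
  by case/lcosetP=> m Mm ->; rewrite groupMr.
have sBM' : B \subset M := subset_trans sBM (subD1set _ _).
exists (B :|: e *: M), A; split.
- apply/eqP; rewrite eqEsubset gen_subG subUset.
  rewrite (subset_trans sBM' sMU) /=; apply/andP; split.
    by apply/subsetP=> _ /lcosetP[m Mm ->]; rewrite groupM // (subsetP sMU).
  have sM : M \subset <<B :|: e *: M>>.
    apply/subsetP=> m Mm; rewrite -[m](mulKg e) groupM ?groupV ?mem_gen //.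
      by rewrite inE lcoset_refl orbT.
    by rewrite inE mem_lcoset mulKg Mm orbT.
  by rewrite -genU gen_subG subUset sM sub1set mem_gen // inE lcoset_refl orbT.
- rewrite subUset (subset_trans sBM) ?setSD //=.
  apply/subsetP=> w eMw; rewrite !inE.
  have:= eM1 w eMw; case: eqP => [->|_ _]; first by rewrite group1.
  by case/lcosetP: eMw => m Mm ->; rewrite groupM // (subsetP sMU).
- exact: subset_trans sAM (setSD _ sMU).
- rewrite -setI_eq0 setIUl setU_eq0 !setI_eq0 disjoint_sym dAB /=.
  rewrite disjoint_subset; apply/subsetP=> w /eM1; apply: contraNN.
  by case/(subsetP sAM)/setD1P.
move=> y coUy nBy nAy.
have nMy : y \in 'N(M).
  by rewrite -sub1set -genA norms_gen // sub1set.
have memJM := memJ_norm _ nMy.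
have defB : B = (B :|: e *: M) :&: M.
  rewrite setIUl (setIidPl sBM').
  suff -> : e *: M :&: M = set0 by rewrite setU0.
  by apply/setP=> w; rewrite !inE; apply/negP=> /andP[/eM1/negP].
have defE : e *: M = (B :|: e *: M) :\: M.
  rewrite setDUl.
  have /eqP-> : B :\: M == set0 by rewrite setD_eq0.
  rewrite set0U; apply/setP=> w; rewrite in_setD.
  by case: (boolP (w \in e *: M)) => [/eM1->|]; rewrite ?andbF.
have nB'y : y \in 'N(B).
  by rewrite defB; apply/normP; rewrite conjIg (normP nBy) (normP nMy).
have nEy : y \in 'N(e *: M).
  by rewrite defE; apply/normP; rewrite conjDg (normP nBy) (normP nMy).
have cMy : y \in 'C(M).
  by apply: rigid => //; apply: coprime_dvdl coUy; apply: cardSg.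
have: e ^ y \in e *: M by rewrite memJ_norm // lcoset_refl.
case/lcosetP=> m Mm eJy.
(* As [y] centralises [m], each conjugation by [y] contributes one more factor [m]. Taking [k =
   #[y]] gives [m ^+ #[y] = 1], and coprimality forces [m = 1]. *)
have eJX k : e ^ (y ^+ k) = e * m ^+ k.
  elim: k => [|k IHk]; first by rewrite conjg1 mulg1.
  rewrite expgSr conjgM IHk conjMg eJy -mulgA expgS; congr (_ * (_ * _)).
  by apply/conjg_fixP/commgP; apply/commute_sym/commuteX/(centP cMy).
have m1 : m = 1.
  have:= eJX #[y]; rewrite expg_order conjg1 => /eqP.
  rewrite -{1}[e]mulg1 (inj_eq (mulgI e)) eq_sym => /eqP my1.
  apply/eqP; rewrite -order_eq1 -dvdn1 -(eqnP coUy) dvdn_gcd order_dvdG ?(subsetP sMU) //=.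
  by rewrite order_dvdn my1.
rewrite -genU cent_gen centU inE cent_set1 cMy andbT.
by apply/cent1P/commute_sym/commgP/conjg_fixP; rewrite eJy m1 mulg1.
Qed.

(** * Coprime action on abelian groups, and regularity *)

(** [Q] acts trivially on the quotient of [V] by [[~: V, Q]], and by coprimality the fixed points
    there lift to ['C_V(Q)]. *)
Lemma coprime_abelian_comm_cent (gT : finGroupType) (Q V : {group gT}) :
  Q \subset 'N(V) -> coprime #|V| #|Q| -> abelian V ->
  [~: V, Q] * 'C_V(Q) = V.
Proof.
move=> nVQ coVQ abV; have sWV : [~: V, Q] \subset V by rewrite commg_subl.
have nWV : V \subset 'N([~: V, Q]) by rewrite commg_norml.
apply/eqP; rewrite eqEsubset mul_subG ?subsetIl //= -quotientSK //.
rewrite coprime_norm_quotient_cent ?commg_normr ?(coprimeSg sWV) //.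
  by rewrite subsetI subxx quotient_cents2r.
exact: solvableS sWV (abelian_sol abV).
Qed.

(** Since [v] commutes with the transitive group [V], fixing one point makes it fix them all. *)
Lemma abelian_trans_regular (gT : finGroupType) (T : finType)
    (G V : {group gT}) (to : {action gT &-> T}) t v :
  [faithful G, on [set: T] | to] -> V \subset G -> abelian V ->
  [transitive V, on [set: T] | to] -> v \in V -> to t v = t -> v = 1.
Proof.
move=> faithG sVG abV transV Vv tv.
apply: (faithfulP faithG); first exact: subsetP sVG v Vv.
move=> s _; have [w Vw ->] := atransP2 transV (in_setT t) (in_setT s).
by rewrite -actM (centsP abV w Vw v Vv) actM tv.
Qed.

(** * The case where p does not divide the order of V *)

Lemma moderate_coprime (gT : finGroupType) (T : finType) (G V : {group gT})
    (to : {action gT &-> T}) (p : nat) :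
  [faithful G, on [set: T] | to] -> V <| G -> abelian V ->
  [transitive V, on [set: T] | to] -> prime p -> ~~ (p %| #|V|)%N ->
  (p ^ 2 %| #|G|)%N -> p_moderate G to p.
Proof.
move=> faithG /andP[sVG nVG] abV transV p_pr p'V p2G.
have regV := abelian_trans_regular faithG sVG abV transV.
have pG : (p %| #|G|)%N by apply: dvdn_trans p2G; rewrite dvdn_exp.
have [x0 Gx0 ox0] := Cauchy p_pr pG.
have Px0 : (x0 \in G) && (#[x0] == p) by rewrite Gx0 ox0 eqxx.
case: (arg_maxnP (P := fun x => (x \in G) && (#[x] == p))
         (fun x => #|'Fix_to[x]|) Px0) => x /andP[Gx /eqP ox] maxx {x0 Gx0 ox0 Px0}.
pose Q := <[x]>%G.
have nVQ : Q \subset 'N(V) by rewrite cycle_subG (subsetP nVG).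
have coVQ : coprime #|V| #|Q|.
  by rewrite -orderE ox coprime_sym prime_coprime.
have oT : #|T| = #|V|.
  have [t _ defT] := imsetP transV; rewrite -cardsT defT card_orbit.
  suff -> : 'C_V[t | to] = 1 by rewrite indexg1.
  by apply/trivgP/subsetP=> v /setIP[Vv /astab1P/regV v1]; rewrite inE v1.
(* The number of fixed points of the p-group [Q] is congruent to [#|T| = #|V|] modulo [p], hence
   nonzero. The point [t0] is the origin that identifies [V] with [T] through [to t0]; elements
   fixing [t0] then act by conjugation. *)
have [t0 tx] : exists t0, to t0 x = t0.
  have pQ : p.-group Q by rewrite /pgroup -orderE ox pnat_id.
  have actsQ : [acts Q, on setT | to].
    by apply/subsetP=> y _; apply/astabsP=> s; rewrite !inE.
  have := pgroup_fix_mod pQ actsQ; rewrite setTI cardsT oT afix_cycle.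
  case: (set_0Vmem 'Fix_to[x]) => [->|[t /afix1P tx _]]; last by exists t.
  by rewrite cards0 mod0n => /eqP; rewrite -/(dvdn _ _) (negPf p'V).
pose U := 'C_V(Q)%G; pose W := [~: V, Q]%G.
have sUV : U \subset V := subsetIl _ _.
have sWV : W \subset V by rewrite commg_subl.
have defV : W * U = V := coprime_abelian_comm_cent nVQ coVQ abV.
have tiWU : W :&: U = 1.
  by apply/trivgP; rewrite -(coprime_abel_cent_TI nVQ coVQ abV) setIS ?subsetIr.
have tiWUP w : w \in W -> w \in U -> w = 1.
  by move=> Ww Uw; apply/set1gP; rewrite -tiWU inE Ww.
have toJ h v : to t0 h = t0 -> to (to t0 v) h = to t0 (v ^ h).
  by move=> th; rewrite -actM conjgC actM th.
have to_inj : {in V &, injective (to t0)}.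
  move=> v w Vv Vw /(canRL (actK _ _)); rewrite -actM => /esym/regV vw1.
  by apply/esym/eqP; rewrite eq_mulgV1 vw1 ?groupM ?groupV.
have toV t : exists2 v, v \in V & t = to t0 v.
  by have [v Vv ->] := atransP2 transV (in_setT t0) (in_setT t); exists v.
have UxP u : u \in U -> u ^ x = u.
  by case/setIP=> _ /centP/(_ x (cycle_id x)) cux; apply/conjg_fixP/commgP.
have UP u : u \in V -> u ^ x = u -> u \in U.
  move=> Vu ux; rewrite inE Vu /= cent_cycle; apply/cent1P.
  by apply/commgP/conjg_fixP.
have fixx : 'Fix_to[x] = to t0 @: U.
  apply/setP=> t; apply/afix1P/imsetP=> [|[u Uu ->]]; last by rewrite toJ ?UxP.
  have [v Vv ->] := toV t; rewrite toJ // => /to_inj vx.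
  by exists v; rewrite // UP // vx // memJ_norm // (subsetP nVG).
(* If [W] were trivial, then [V = U] and [x] would fix every point, against faithfulness. *)
have [b Wb ntb] : exists2 b, b \in W & b != 1.
  apply/trivgPn; apply: contraTneq (prime_gt1 p_pr) => W1.
  rewrite -ox order_gt1 negbK; apply/eqP/(faithfulP faithG) => // t _.
  have [v Vv ->] := toV t; rewrite toJ // UxP //.
  by move: Vv; rewrite -{1}defV W1 mul1g.
have [A [B [genA sAU sBU dAB rigid]]] := rigid_pair U.
(* The fibres over 1, A, B and the rest of U have pairwise distinct sizes:
   1 < #|b ^: Q| < #|W|, against 1, #|W| and 0. *)
pose F a : {set gT} :=
  if a == 1 then b ^: Q else if a \in A then 1 else if a \in B then W : {set _}
  else set0.
pose D := \bigcup_(a in U) F a :* a.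
have nWQ : Q \subset 'N(W) by apply: commg_normr.
have sbQW : b ^: Q \subset W by rewrite class_sub_norm.
have ltbQW : #|b ^: Q| < #|W|.
  apply/proper_card/properP; split=> //; exists 1; rewrite ?group1 //.
  by apply/imsetP=> [[q _ /esym/eqP]]; rewrite conjg_eq1 (negPf ntb).
have bx : b ^ x != b.
  apply: contraNneq ntb => bx; apply/eqP/tiWUP; rewrite // UP //.
  exact: subsetP sWV b Wb.
have gt1bQ : 1 < #|b ^: Q|.
  apply/card_gt1P; exists (b ^ x), b; split; rewrite ?class_refl //.
  by rewrite imset_f ?cycle_id.
have sFW a : F a \subset W.
  by rewrite /F; do 3?case: ifP => // _; rewrite ?sub1G ?sub0set.
have FJ a w : w \in F a -> w ^ x \in F a.
  rewrite /F; case: ifP => _.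
    by case/imsetP=> q Qq ->; rewrite -conjgM imset_f // groupM ?cycle_id.
  case: ifP => _; first by move/set1gP->; rewrite conj1g set11.
  by case: ifP => _; rewrite ?inE // memJ_norm // (subsetP nWQ) ?cycle_id.
(* The cosets [W :* a] for distinct [a] in [U] are disjoint because [W] meets [U] trivially, so [D]
   determines each fibre. *)
have Dfib a : a \in U -> D :&: W :* a = F a :* a.
  move=> Ua; apply/setP=> d; rewrite inE; apply/andP/idP=> [|Fd].
    case=> /bigcupP[c Uc /rcosetP[w Fw ->]] /rcosetP[w' Ww' eqwa].
    have Ww := subsetP (sFW c) w Fw.
    suff -> : a = c by rewrite mem_rcoset mulgK.
    have eqac : w'^-1 * w = a * c^-1 by rewrite -[a](mulKg w') -eqwa !mulgA mulgK.
    have /eqP : a * c^-1 = 1.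
      by apply: tiWUP; [rewrite -eqac|]; rewrite groupM ?groupV.
    by rewrite -eq_mulgV1 => /eqP.
  split; first by apply/bigcupP; exists a.
  by apply: subsetP Fd; apply: mulSg.
have sDV : D \subset V.
  apply/bigcupsP=> a Ua; by rewrite -defV mulgSS ?sub1set.
have DJ d : d \in D -> d ^ x \in D.
  case/bigcupP=> a Ua /rcosetP[w Fw ->]; rewrite conjMg (UxP a) //.
  by apply/bigcupP; exists a; rewrite // mem_rcoset mulgK FJ.
exists (to t0 @: D); set S := 'N_G(_ | to).
have Sx : x \in S.
  rewrite inE Gx !inE; apply/subsetP=> _ /imsetP[d Dd ->].
  by rewrite inE toJ // imset_f // DJ.
have pS : p %| #|S| by rewrite -ox order_dvdG.
apply/andP; split; first by rewrite p_part_gt1 mem_primes p_pr cardG_gt0.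
rewrite ltn_neqAle dvdn_leq ?part_gt0 ?partn_dvd ?cardSg ?subsetIl // andbT.
(* Suppose the stabiliser has full p-part. A Sylow p-subgroup [R] of it containing [Q] then has
   order at least [p ^ 2], so it is larger than [Q]. *)
apply/eqP=> eqS.
have oQ : #|Q| = p by rewrite -orderE.
have pQ : p.-group Q by rewrite /pgroup oQ pnat_id.
have sQS : Q \subset S by rewrite cycle_subG.
have [R sylR sQR] := Sylow_superset sQS pQ.
have [sRS pR _] := and3P sylR.
have ltQR : #|Q| < #|R|.
  rewrite (card_Hall sylR) eqS oQ p_part -[X in X < _]expn1.
  by rewrite ltn_exp2l ?(prime_gt1 p_pr) // -pfactor_dvdn ?cardG_gt0.
have Rx : x \in R by rewrite (subsetP sQR) ?cycle_id.
(* A central element of [R] outside [Q] will do. If there is none, the nontrivial centre of [R]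
   equals [Q], so [x] is central and any element of [R] outside [Q] will do. *)
have [y Ry [cxy notQy]] : exists2 y, y \in R & commute x y /\ y \notin Q.
  have [sZQ | /subsetPn[y /centerP[Ry cRy] notQy]] := boolP ('Z(R) \subset Q).
    have eqZQ : 'Z(R) = Q.
      apply/eqP; rewrite eqEcard sZQ /= oQ.
      have := cardSg sZQ; rewrite oQ => /(prime_nt_dvdP p_pr)-> //.
      rewrite -trivg_card1; apply: contraTneq ltQR => /(trivg_center_pgroup pR)->.
      by rewrite cards1 ltnS -ltnNge oQ prime_gt0.
    have /subsetPn[y Ry notQy] : ~~ (R \subset Q).
      by apply: contraTN ltQR => /subset_leq_card; rewrite -leqNgt.
    exists y => //; split=> //.
    have /centerP[_ cRx] : x \in 'Z(R) by rewrite eqZQ cycle_id.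
    exact: cRx.
  by exists y => //; split=> //; apply/commute_sym/cRy.
have /setIP[Gy nDy] := subsetP sRS y Ry.
(* Commuting with [x], [y] permutes the fixed points of [x]. It therefore acts on [V] as the affine
   map sending [v] to [v ^ h * u], with [h] fixing the origin. *)
have /imsetP[u Uu t0y] : to t0 y \in to t0 @: U.
  by rewrite -fixx; apply/afix1P; rewrite -actM -cxy actM tx.
pose h := y * u^-1.
have th : to t0 h = t0 by rewrite actM t0y actK.
have defy : y = h * u by rewrite mulgKV.
have [Vu cQu] := setIP Uu.
have Gh : h \in G by rewrite groupM // groupV (subsetP sVG).
have cQh : h \in 'C(Q).
  by rewrite groupM ?groupV //= cent_cycle; apply/cent1P/commute_sym.
have nVh : h \in 'N(V) := subsetP nVG h Gh.
have nQh : h \in 'N(Q) := subsetP (cent_sub _) h cQh.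
have nWh : h \in 'N(W).
  by apply/normP; rewrite /= conjsRg (normP nVh) (normP nQh).
have nUh : h \in 'N(U).
  by apply/normP; rewrite /= conjIg -centJ (normP nVh) (normP nQh).
have Dh : D :^ h :* u = D.
  apply/eqP; rewrite eqEcard card_rcoset cardJg leqnn andbT.
  apply/subsetP=> _ /rcosetP[_ /imsetP[d Dd ->] ->].
  have Vd := subsetP sDV d Dd.
  have : to (to t0 d) y \in to t0 @: D by rewrite astabs_act // imset_f.
  rewrite defy actM toJ // -actM => /imsetP[d' Dd' /to_inj-> //].
    by rewrite groupM // memJ_norm.
  exact: subsetP sDV d' Dd'.
(* The affine map preserves [D] and carries the coset of [W] through [a] to the one through
   [a ^ h * u]. *)
have cardF a : a \in U -> #|F (a ^ h * u)| = #|F a|.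
  move=> Ua; have Uahu : a ^ h * u \in U by rewrite groupM // memJ_norm.
  rewrite -(card_rcoset (F a) a) -Dfib // -(card_rcoset _ (a ^ h * u)) -Dfib //.
  rewrite -[RHS](cardJg _ h) -[RHS](card_rcoset _ u) conjIg conjsMg conjg_set1.
  rewrite (normP nWh) -{1}Dh; congr #|pred_of_set _|.
  by apply/setP=> d; rewrite rcosetM !inE !mem_rcoset !inE !mem_rcoset.
have F1 : F 1 = b ^: Q by rewrite /F eqxx.
(* Only the fibre over [1] has size [#|b ^: Q|], so the translation part vanishes and [y] fixes the
   origin. *)
have u1 : u = 1.
  have := cardF 1 (group1 U); rewrite conj1g mul1g F1 /F.
  case: eqP => // _; do 2?case: ifP => _; move=> oF; move: gt1bQ ltbQW.
  - by rewrite -oF cards1.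
  - by rewrite -oF ltnn.
  - by rewrite -oF cards0.
have {}defy : y = h by rewrite defy u1 mulg1.
rewrite {}u1 -{h}defy in th Gh cQh nVh nQh nWh nUh Dh cardF * => {Uu Vu cQu t0y}.
have {}cardF a : a \in U -> #|F (a ^ y)| = #|F a|.
  by move=> Ua; rewrite -(cardF a Ua) mulg1.
have gt1W := ltn_trans gt1bQ ltbQW.
have nAy : y \in 'N(A).
  rewrite inE; apply/subsetP=> _ /imsetP[a Aa ->].
  have /setD1P[nta Ua] := subsetP sAU a Aa.
  have := cardF a Ua; rewrite /F conjg_eq1 (negPf nta) Aa.
  case: ifP => // _; case: ifP => _; rewrite ?cards0 cards1 // => oW.
  by move: gt1W; rewrite oW.
have nBy : y \in 'N(B).
  rewrite inE; apply/subsetP=> _ /imsetP[a Ba ->].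
  have /setD1P[nta Ua] := subsetP sBU a Ba.
  have := cardF a Ua; rewrite /F conjg_eq1 (negPf nta) Ba.
  rewrite (disjointFl dAB Ba); case: ifP => _; last first.
    by case: ifP => // _ oW; move: gt1W; rewrite -oW cards0.
  by rewrite cards1 => oW; move: gt1W; rewrite -oW.
have p'U : p^'.-group U.
  by apply: pgroupS sUV _; rewrite /pgroup p'natE.
have cUy : y \in 'C(U).
  apply: rigid => //; rewrite coprime_sym.
  exact: pnat_coprime (mem_p_elt pR Ry) p'U.
have Db : b \in D.
  have : b \in F 1 :* 1 by rewrite F1 rcoset1 class_refl.
  by rewrite -Dfib // => /setIP[].
(* Since [y] preserves the fibre over [1], it moves [b] within its [Q]-class. Correcting [y] by an
   element of [Q] gives a nontrivial [z] that fixes [b] as well as all of [U]. *)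
have /imsetP[q Qq byq] : b ^ y \in b ^: Q.
  rewrite -F1 -[F 1]rcoset1 -Dfib // rcoset1 inE (memJ_norm _ nWh) Wb andbT.
  by rewrite -{1}Dh rcoset1 memJ_conjg.
pose z := y * q^-1.
have Rq := subsetP sQR q Qq.
have Rz : z \in R by rewrite groupM ?groupV.
have ntz : z != 1 by apply: contraNneq notQy => /eqP; rewrite -eq_mulgV1 => /eqP->.
have tz : to t0 z = t0.
  have /afixP tq : t0 \in 'Fix_to(Q) by rewrite afix_cycle; apply/afix1P.
  by rewrite actM th; apply: tq; rewrite groupV.
have bz : b ^ z = b by rewrite conjgM byq conjgK.
have cUz : z \in 'C(U).
  by rewrite groupM ?groupV // (subsetP _ q Qq) // centsC subsetIr.
have pz : p.-group <[z]> by rewrite (pgroupS _ pR) ?cycle_subG.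
have ntCz : <[z]>%G != 1 :> {set gT} by rewrite cycle_eq1.
have [_ pdvz _] := pgroup_pdiv pz ntCz.
(* The order of [z] may exceed [p]; a power [s] of order [p] keeps all fixed points of [z]. These
   include those of [x] and also [to t0 b], against the maximality of [x]. *)
have [s zs os] := Cauchy p_pr pdvz.
have Rs : s \in R by apply: subsetP zs; rewrite cycle_subG.
have Gs : s \in G by have /setIP[] := subsetP sRS s Rs.
have fixs v : v ^ z = v -> to t0 v \in 'Fix_to[s].
  move=> vz; have : to t0 v \in 'Fix_to(<[z]>).
    by rewrite afix_cycle; apply/afix1P; rewrite toJ ?vz.
  by move/afixP/(_ s zs)/afix1P.
have : #|'Fix_to[s]| <= #|'Fix_to[x]| by apply: maxx; rewrite Gs os eqxx.
rewrite leqNgt => /negP[]; apply/proper_card/properP; split.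
  rewrite fixx; apply/subsetP=> _ /imsetP[v Uv ->]; apply: fixs.
  by apply/conjg_fixP/commgP/commute_sym/(centP cUz).
exists (to t0 b); first exact: fixs.
apply: contra ntb; rewrite fixx => /imsetP[v Uv /to_inj eqbv].
have {}eqbv : b = v by apply: eqbv; [apply: subsetP sWV b Wb | apply: subsetP sUV v Uv].
by apply/eqP/tiWUP; rewrite // eqbv.
Qed.

(** * The case where V is a p-group *)

Lemma moderate_pgroup (gT : finGroupType) (T : finType) (G V : {group gT})
    (to : {action gT &-> T}) (p : nat) :
  V <| G -> p.-group V -> [transitive V, on [set: T] | to] ->
  prime p -> (1 < #|T|)%N -> (p ^ 2 %| #|G|)%N -> p_moderate G to p.
Proof.
move=> nsVG pV transV p_pr gt1T p2G.
have pG : (p %| #|G|)%N by apply: dvdn_trans p2G; rewrite dvdn_exp.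
suff [Delta [ntD prD pD]] : exists Delta : {set T},
    [/\ Delta != set0, Delta != setT & p %| #|'N_G(Delta | to)|].
  exists Delta; apply/andP; split.
    by rewrite p_part_gt1 mem_primes p_pr cardG_gt0.
  rewrite ltn_neqAle dvdn_leq ?part_gt0 ?partn_dvd ?cardSg ?subsetIl // andbT.
  apply: contraNneq prD => eqD.
  have [R sylR] := Sylow_exists p 'N_G(Delta | to).
  have [sRN pR _] := and3P sylR.
  have sylRG : p.-Sylow(G) R.
    rewrite pHallE (subset_trans sRN) ?subsetIl //=.
    by rewrite (card_Hall sylR) eqD.
  have sVR : V \subset R.
    exact: subset_trans (pcore_max pV nsVG) (pcore_sub_Hall sylRG).
  have /set0Pn[t Dt] := ntD; rewrite eqEsubset subsetT; apply/subsetP=> s _.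
  have [v Vv ->] := atransP2 transV (in_setT t) (in_setT s).
  have /setIP[_ nDv] := subsetP sRN v (subsetP sVR v Vv).
  by rewrite astabs_act.
have [t _ _] := imsetP transV.
(* If [#|T| = p], a point stabiliser has index [p], so its order is still divisible by [p].
   Otherwise an orbit of an element of order [p] works: its size divides [p], so it cannot be all of
   [T]. *)
have [eqTp | neTp] := eqVneq #|T| p.
  exists [set t]; split.
  - by apply/set0Pn; exists t; rewrite set11.
  - by apply: contraTneq gt1T => tT; rewrite -cardsT -tT cards1.
  have defN : 'C_G[t | to] \subset 'N_G([set t] | to) by rewrite setIS ?astab_sub.
  apply: dvdn_trans (cardSg defN).
  have transG : [transitive G, on setT | to].
    rewrite (atrans_supgroup (normal_sub nsVG) transV).
    by apply/subsetP=> g _; apply/astabsP=> s; rewrite !inE.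
  have := card_orbit_stab to G t; rewrite (atransP transG) ?inE // cardsT eqTp.
  by move=> oG; move: p2G; rewrite -oG expnS dvdn_pmul2l ?prime_gt0.
have [x Gx ox] := Cauchy p_pr pG.
exists (orbit to <[x]> t); split.
- by apply/set0Pn; exists t; apply: orbit_refl.
- apply: contraNneq neTp => oxt.
  have : #|T| %| p by rewrite -cardsT -oxt card_orbit -ox orderE dvdn_indexg.
  by move/(prime_nt_dvdP p_pr)-> => //; rewrite neq_ltn gt1T orbT.
rewrite -ox order_dvdG // inE Gx.
by apply: subsetP (cycle_id x); apply: acts_orbit; apply: subsetT.
Qed.

(** * Reduction to the two cases through a minimal normal subgroup *)

Theorem theoremA (gT : finGroupType) (T : finType) (G : {group gT})
    (to : {action gT &-> T}) (p : nat)
    (faithG : [faithful G, on [set: T] | to])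
    (primG : [primitive G, on [set: T] | to])
    (solG : solvable G)
    (p_prime : prime p)
    (p2_dvd_G : (p ^ 2 %| #|G|)%N) :
  p_moderate G to p.
Proof.
have ntG : G :!=: 1.
  apply: contraTneq p2_dvd_G => ->.
  by rewrite cards1 gtnNdvd // -(exp1n 2) ltn_exp2r // prime_gt1.
have [V minV sVG] := minnormal_exists ntG (normG G).
have [_ ntV /is_abelemP[r r_pr abelV]] := minnormal_solvable minV sVG solG.
have nsVG : V <| G by have [/andP[_ nVG] _] := mingroupP minV; apply/andP.
have transV : [transitive V, on [set: T] | to].
  (* A normal subgroup of a primitive group is transitive or acts trivially; faithfulness excludes
     the latter for [V]. *)
  have [sVC|//] := prim_trans_norm primG nsVG.
  by case/negP: ntV; rewrite -subG1 (subset_trans sVC).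
have [pV | p'V] := boolP (p %| #|V|); last first.
  exact: moderate_coprime (abelem_abelian abelV) transV _ _ _.
have rp : r = p.
  by apply/esym/eqP; apply: (pgroupP (abelem_pgroup abelV)).
apply: moderate_pgroup transV _ _ _ => //.
  by rewrite -rp abelem_pgroup.
(* On at most one point [V] would act trivially, hence be trivial by faithfulness. *)
rewrite ltnNge; apply: contraNN ntV => leT1; rewrite -subG1.
apply: subset_trans faithG; rewrite subsetI sVG; apply/subsetP=> v Vv.
by apply/astabP=> t _; apply: (fintype_le1P leT1).
Qed.
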